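(* Let $\mathbb{F}$ be an algebraically closed field, let $n$ be a positive integer, and let $A=M_n(\mathbb{F})$. A subset $M\subseteq A$ belongs to $\mathcal{M}_s$ if and only if $M$ is one of the four subsets $$\{0\},\quad \mathbb{F}E,\quad A_s,\quad A_s\cap A_0.$$
   Context: $A_s\subseteq A$ is the set of all diagonalizable matrices, $A_0\subseteq A$ is the subspace of all matrices of trace $0$, and $E$ is the identity matrix. $\mathcal{M}_s$ denotes the family of all subsets $M\subseteq A_s$ such that: (i) $0\in M$; (ii) $gMg^{-1}=M$ for every invertible $g\in A$; (iii) for all $X,Y\in M$ with $XY=YX$, the linear span $\langle X,Y\rangle$ is contained in $M$. *)

(* Defs.v *)
From mathcomp Require Import all_boot all_order all_algebra.
From mathcomp Require Import classical_sets.

Set Implicit Arguments.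
Unset Strict Implicit.
Unset Printing Implicit Defensive.

Import GRing.Theory.
Local Open Scope ring_scope.
Local Open Scope classical_set_scope.

Section MatrixSubsets.
Variables (F : fieldType) (n : nat).

Definition diagonalizable_set : set 'M[F]_n := [set X | diagonalizable X].

Definition trace0_set : set 'M[F]_n := [set X | \tr X = 0].

Definition scalar_set : set 'M[F]_n := range (fun a : F => a%:M).

Record in_Ms (M : set 'M[F]_n) : Prop := InMs {
  Ms_diag : M `<=` diagonalizable_set;
  Ms_zero : M 0;
  Ms_conj : forall g : 'M[F]_n, g \in unitmx ->
    [set g *m X *m invmx g | X in M] = M;
  Ms_span : forall X Y : 'M[F]_n, M X -> M Y -> X *m Y = Y *m X ->
    [set Z | Z \in <<[:: X; Y]>>%VS] `<=` M
}.

End MatrixSubsets.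

(* Main.v *)
Require Import Defs.
From mathcomp Require Import all_boot all_order all_algebra.
From mathcomp Require Import fingroup perm.
From mathcomp Require Import boolp classical_sets.

Set Implicit Arguments.
Unset Strict Implicit.
Unset Printing Implicit Defensive.

Import GRing.Theory.
Local Open Scope ring_scope.
Local Open Scope classical_set_scope.

(** Two diagonalizable matrices that commute are simultaneously diagonalizable,
    so the diagonalizable matrices are closed under spans of commuting pairs;
    hence so is their intersection with any conjugation-invariant linear
    subspace. The four listed sets are of this form ([in_Ms_meet]).

    Conversely, a member [M] of the family consists of diagonalizable matrices
    and is closed under conjugation, so it is determined by the set [V] of
    vectors [d] with [diag_mx d] in [M]. Diagonal matrices commute with each
    other, so [V] is a linear subspace of [F^n]; conjugating by permutation
    matrices shows that [V] is stable under permutations of the coordinates.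
    If [v] in [V] has two different entries [v_i] and [v_j], then subtracting
    from [v] its image under the transposition of [i] and [j] gives a nonzero
    multiple of [e_i - e_j]; the permutations turn this into all differences
    of basis vectors, and these span the hyperplane of vectors of sum zero
    ([sum0_in_perm_subspace]). So [V] is the zero space, the line of constant
    vectors, the hyperplane, or the whole space, and these correspond to the
    four sets. The argument holds in every characteristic; when [n = 1], or when
    [n = 2] in characteristic 2, some of the four sets coincide, which does no
    harm. *)

(** * Diagonalizable matrices *)

Section Diagonalizable.
Variables (F : fieldType) (n : nat).
Implicit Types (X Y Z g : 'M[F]_n) (d : 'rV[F]_n).

Lemma diagonalizableE X :
  diagonalizable X <->
  exists g d, g \in unitmx /\ X = g *m diag_mx d *m invmx g.
Proof.
split=> [[P Pu /(similar_diagLR Pu)[d ->]]|[g [d [gu ->]]]].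
  exists (invmx P), d; rewrite unitmx_inv; split=> //.
  by rewrite conjumx ?unitmx_inv.
have Pu : invmx g \in unitmx by rewrite unitmx_inv.
exists (invmx g) => //; apply/(similar_diagLR Pu).
by exists d; rewrite invmxK conjumx.
Qed.

Lemma diagonalizable_conj g X : g \in unitmx ->
  diagonalizable X -> diagonalizable (g *m X *m invmx g).
Proof.
move=> gu /diagonalizableE[h [d [hu ->]]]; apply/diagonalizableE.
have ghu : g *m h \in unitmx by rewrite unitmx_mul gu.
by exists (g *m h), d; split; rewrite // -!conjumx // conjuMumx.
Qed.

Lemma diagonalizable_comm_comb (a b : F) X Y :
  diagonalizable X -> diagonalizable Y -> X *m Y = Y *m X ->
  diagonalizable (a *: X + b *: Y).
Proof.
move=> dX dY cXY.
have /codiagonalizableP[P Pu /and3P[PX PY _]] :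
    {in [:: X; Y] &, forall A B, comm_mx A B} /\
    (forall A, A \in [:: X; Y] -> diagonalizable A).
  split=> [A B|A]; rewrite !inE; last by case/orP=> /eqP->.
  by move=> /orP[]/eqP-> /orP[]/eqP->; rewrite /comm_mx.
have [[dx ->] [dy ->]] := (similar_diagLR Pu PX, similar_diagLR Pu PY).
apply/diagonalizableE; exists (invmx P), (a *: dx + b *: dy).
have Pu' : invmx P \in unitmx by rewrite unitmx_inv.
rewrite Pu' !conjumx // linearD !linearZ /= mulmxDr mulmxDl.
by rewrite -!scalemxAr -!scalemxAl.
Qed.

Lemma conj_scalar_mx g (a : F) : g \in unitmx ->
  g *m a%:M *m invmx g = a%:M.
Proof. by move=> gu; rewrite scalar_mxC mulmxK. Qed.

Lemma conj_perm_diag_mx (s : 'S_n) d :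
  perm_mx s *m diag_mx d *m invmx (perm_mx s) = diag_mx (col_perm s d).
Proof.
have -> : invmx (perm_mx s) = perm_mx (s^-1)%g :> 'M[F]_n.
  apply: (can_inj (mulKmx (unitmx_perm F s))).
  by rewrite mulmxV ?unitmx_perm // -perm_mxM mulgV perm_mx1.
rewrite -row_permE -col_permE; apply/matrixP=> i j.
by rewrite !mxE (inj_eq perm_inj).
Qed.

Lemma mem_span2 X Y Z :
  (Z \in <<[:: X; Y]>>%VS) <-> exists a b, Z = a *: X + b *: Y.
Proof.
rewrite span_cons span_seq1; split=> [/memv_addP[u /vlineP[a ->]]|[a [b ->]]].
  by move=> [v /vlineP[b ->] ->]; exists a, b.
by rewrite memv_add // memvZ // memv_line.
Qed.

(** * Sets of diagonalizable matrices cut out by invariant subspaces *)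

(** Commuting pairs matter only for the diagonalizable part, where they allow
    simultaneous diagonalization; [S] contributes plain linear closure. *)
Lemma in_Ms_meet (S : set 'M[F]_n) :
  S 0 ->
  (forall a b X Y, S X -> S Y -> S (a *: X + b *: Y)) ->
  (forall g X, g \in unitmx -> S X -> S (g *m X *m invmx g)) ->
  in_Ms (@diagonalizable_set F n `&` S).
Proof.
move=> S0 Slin Sconj.
have Mconj g X : g \in unitmx -> (@diagonalizable_set F n `&` S) X ->
    (@diagonalizable_set F n `&` S) (g *m X *m invmx g).
  by move=> gu [dX SX]; split; [apply: diagonalizable_conj|apply: Sconj].
split.
- by move=> X [].
- by split=> //; apply: diagonalizable0.
- move=> g gu; apply/seteqP; split=> [_ [X MX <-]|X MX]; first exact: Mconj.
  exists (invmx g *m X *m g); last by rewrite -!mulmxA mulmxV // mulmx1 mulKVmx.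
  by rewrite -[X in _ *m X]invmxK; apply: Mconj; rewrite ?unitmx_inv.
- move=> X Y [dX SX] [dY SY] cXY Z /= /mem_span2[a [b ->]].
  by split; [apply: diagonalizable_comm_comb|apply: Slin].
Qed.

Lemma in_Ms_zero : in_Ms [set (0 : 'M[F]_n)].
Proof.
have sub : [set (0 : 'M[F]_n)] `<=` @diagonalizable_set F n.
  by move=> _ ->; apply: diagonalizable0.
rewrite -(setIidr sub); apply: in_Ms_meet => // [a b X Y -> ->|g X _ ->].
  by rewrite /= !scaler0 addr0.
by rewrite /= mulmx0 mul0mx.
Qed.

Lemma in_Ms_scalar : in_Ms (@scalar_set F n).
Proof.
have sub : @scalar_set F n `<=` @diagonalizable_set F n.
  by move=> _ [a _ <-]; apply: diagonalizable_scalar.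
rewrite -(setIidr sub).
apply: in_Ms_meet => [|a b _ _ [x _ <-] [y _ <-]|g _ gu [x _ <-]].
- by exists 0; rewrite ?raddf0.
- by exists (a * x + b * y); rewrite // raddfD /= -!scale_scalar_mx.
- by exists x; rewrite // conj_scalar_mx.
Qed.

Lemma in_Ms_diagonalizable : in_Ms (@diagonalizable_set F n).
Proof. by rewrite -[@diagonalizable_set F n]setIT; apply: in_Ms_meet. Qed.

Lemma in_Ms_trace0 : in_Ms (@diagonalizable_set F n `&` @trace0_set F n).
Proof.
apply: in_Ms_meet => [|a b X Y trX trY|g X gu trX]; rewrite /trace0_set /=.
- exact: mxtrace0.
- by rewrite mxtraceD !mxtraceZ trX trY !mulr0 addr0.
- by rewrite mxtrace_mulC mulmxA mulVmx // mul1mx.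
Qed.

End Diagonalizable.

(** * Subspaces of row vectors stable under permutation of the entries *)

Section PermSubspace.
Variables (F : fieldType) (n : nat) (V : set 'rV[F]_n).
Hypotheses (V0 : V 0)
  (Vlin : forall a b u v, V u -> V v -> V (a *: u + b *: v))
  (Vperm : forall (s : 'S_n) u, V u -> V (col_perm s u)).

Local Notation e i := (delta_mx (0 : 'I_1) (i : 'I_n) : 'rV[F]_n).

(** The vector [v] and its image under the transposition of [i] and [j] differ
    by [(v_i - v_j) (e_i - e_j)]. *)
Lemma delta_sub_in_perm_subspace (v : 'rV[F]_n) i j : V v -> v 0 i != v 0 j ->
  V (e i - e j).
Proof.
move=> Vv vij; have vij' : v 0 i - v 0 j != 0 by rewrite subr_eq0.
have ij : i != j by apply: contraNneq vij => ->.
have -> : e i - e j = (v 0 i - v 0 j)^-1 *: v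
    + - (v 0 i - v 0 j)^-1 *: col_perm (tperm i j) v.
  rewrite scaleNr -scalerBr; apply: (scalerI vij'); rewrite scalerA mulfV // scale1r.
  apply/rowP=> k; rewrite !mxE /=.
  case: tpermP => [->|->|/eqP/negPf ki /eqP/negPf kj].
  - by rewrite eqxx (negPf ij) subr0 mulr1.
  - by rewrite eqxx eq_sym (negPf ij) sub0r mulrN1 opprB.
  - by rewrite ki kj !subrr mulr0.
exact/Vlin/Vperm.
Qed.

Lemma delta_sub_perm_transitive i j k : i != j -> V (e i - e j) -> V (e k - e j).
Proof.
move=> ij Vij; have [->|kj] := eqVneq k j; first by rewrite subrr.
have -> : e k - e j = col_perm (tperm i k) (e i - e j).
  apply/rowP=> l; rewrite !mxE /=.
  rewrite -[X in tperm i k l == X](tpermR i k) (inj_eq perm_inj).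
  by rewrite -[X in tperm i k l == X](@tpermD _ i k j) ?(inj_eq perm_inj) // eq_sym.
exact: Vperm.
Qed.

(** A vector [d] of sum zero is the sum of the [d_k (e_k - e_j)]: the terms in
    [e_j] add up to minus the sum of the entries of [d]. *)
Lemma sum0_in_perm_subspace (v : 'rV[F]_n) i j (d : 'rV[F]_n) :
  V v -> v 0 i != v 0 j -> \sum_k d 0 k = 0 -> V d.
Proof.
move=> Vv vij d0; have ij : i != j by apply: contraNneq vij => ->.
have Vij := delta_sub_in_perm_subspace Vv vij.
have -> : d = \sum_k d 0 k *: (e k - e j).
  under eq_bigr do rewrite scalerBr.
  by rewrite sumrB -scaler_suml d0 scale0r subr0 -row_sum_delta.
apply: (big_ind V) => // [x y Vx Vy|k _].
  by rewrite -[x]scale1r -[y]scale1r; apply: Vlin.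
have Vkj := delta_sub_perm_transitive k ij Vij.
by have := Vlin (d 0 k) 0 Vkj V0; rewrite scaler0 addr0.
Qed.

(** A hyperplane together with one vector off it spans everything. *)
Lemma perm_subspace_full (v w : 'rV[F]_n) i j (d : 'rV[F]_n) :
  V v -> v 0 i != v 0 j -> V w -> \sum_k w 0 k != 0 -> V d.
Proof.
move=> Vv vij Vw w0; pose c := (\sum_k d 0 k) / (\sum_k w 0 k).
have -> : d = 1 *: (d - c *: w) + c *: w by rewrite scale1r subrK.
apply: Vlin => //; apply: (sum0_in_perm_subspace Vv vij).
under eq_bigr do rewrite !mxE.
by rewrite sumrB -mulr_sumr divfK // subrr.
Qed.

End PermSubspace.

(** * The classification *)

Section Classification.
Variables (F : fieldType) (n : nat) (M : set 'M[F]_n).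
Hypothesis MM : in_Ms M.

Let V : set 'rV[F]_n := [set d | M (diag_mx d)].

Lemma Ms_conj_mem (g X : 'M[F]_n) : g \in unitmx -> M X -> M (g *m X *m invmx g).
Proof. by move=> gu MX; rewrite -(Ms_conj MM gu); exists X. Qed.

(** The set [M] can be recovered from its diagonal part [V], by conjugation. *)
Lemma Ms_diagE (X : 'M[F]_n) :
  M X <-> exists g d, [/\ g \in unitmx, V d & X = g *m diag_mx d *m invmx g].
Proof.
split=> [MX|[g [d [gu Vd ->]]]]; last exact: Ms_conj_mem.
have /diagonalizableE[g [d [gu XE]]] := Ms_diag MM MX.
exists g, d; split=> //; rewrite /V /=.
have -> : diag_mx d = invmx g *m X *m invmx (invmx g).
  by rewrite XE invmxK !mulmxA mulVmx // mul1mx mulmxKV.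
by apply: Ms_conj_mem => //; rewrite unitmx_inv.
Qed.

Lemma Ms_diag0 : V 0.
Proof. by rewrite /V /= raddf0; apply: Ms_zero MM. Qed.

Lemma Ms_diag_comb a b u v : V u -> V v -> V (a *: u + b *: v).
Proof.
move=> Vu Vv; apply: (Ms_span MM Vu Vv (diag_mxC _ _)).
by apply/mem_span2; exists a, b; rewrite linearD !linearZ.
Qed.

Lemma Ms_diag_perm (s : 'S_n) u : V u -> V (col_perm s u).
Proof.
by move=> Vu; rewrite /V /= -conj_perm_diag_mx; apply: Ms_conj_mem (unitmx_perm _ _) Vu.
Qed.

(** A conjugate of a scalar matrix is the matrix itself, so [M] consists of
    scalar matrices, and one nonzero scalar generates all the others. *)
Lemma Ms_const : (0 < n)%N -> (forall d i j, V d -> d 0 i = d 0 j) ->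
  M = [set 0] \/ M = @scalar_set F n.
Proof.
move=> n0 Vconst; pose i0 := Ordinal n0.
have VE d : V d -> diag_mx d = (d 0 i0)%:M.
  move=> Vd; rewrite -diag_const_mx; congr diag_mx.
  by apply/rowP=> k; rewrite !mxE; apply: Vconst.
have Msub X : M X -> exists2 a, X = a%:M & V (const_mx a).
  move=> /Ms_diagE[g [d [gu Vd ->]]]; exists (d 0 i0).
    by rewrite (VE d Vd) conj_scalar_mx.
  by rewrite /V /= diag_const_mx -VE.
have [[a a0 Va]|noV] := pselect (exists2 a, a != 0 & V (const_mx a)).
  right; apply/seteqP; split=> [X /Msub[b -> _]|_ [b _ <-]]; first by exists b.
  have -> : b%:M = diag_mx ((b / a) *: const_mx a + 0 *: const_mx a) :> 'M[F]_n.
    rewrite scale0r addr0 -diag_const_mx; congr diag_mx.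
    by apply/rowP=> k; rewrite !mxE divfK.
  exact: Ms_diag_comb.
left; apply/seteqP; split=> [X /Msub[a -> Va]|_ ->]; last exact: Ms_zero MM.
have [->|a0] := eqVneq a 0; first by rewrite /= raddf0.
by case: noV; exists a.
Qed.

(** The trace of a matrix conjugate to [diag_mx d] is the sum of the entries of
    [d], so the trace decides whether [V] is the hyperplane or everything. *)
Lemma Ms_nonconst v i j : V v -> v 0 i != v 0 j ->
  M = @diagonalizable_set F n \/
  M = @diagonalizable_set F n `&` @trace0_set F n.
Proof.
move=> Vv vij.
have trE (g : 'M[F]_n) d : g \in unitmx -> \tr (g *m diag_mx d *m invmx g) = \sum_k d 0 k.
  by move=> gu; rewrite mxtrace_mulC mulmxA mulVmx // mul1mx mxtrace_diag.
have [[w Vw w0]|noV] := pselect (exists2 w, V w & \sum_k w 0 k != 0).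
  left; apply/seteqP; split=> [X|X /diagonalizableE[g [d [gu ->]]]].
    exact: (Ms_diag MM).
  apply: Ms_conj_mem => //.
  exact: (perm_subspace_full Ms_diag0 Ms_diag_comb Ms_diag_perm) Vv vij Vw w0.
right; apply/seteqP; split=> [X MX|X [/diagonalizableE[g [d [gu ->]]] trX]].
  split; first exact: (Ms_diag MM) MX.
  have /Ms_diagE[g [d [gu Vd ->]]] := MX; rewrite /trace0_set /= trE //.
  by have [//|d0] := eqVneq (\sum_k d 0 k) 0; case: noV; exists d.
apply: Ms_conj_mem => //.
apply: (sum0_in_perm_subspace Ms_diag0 Ms_diag_comb Ms_diag_perm) Vv vij _.
by rewrite -(trE g d gu).
Qed.

End Classification.

Theorem mainTheorem4 (F : closedFieldType) (n : nat) (hn : (0 < n)%N)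
    (M : set 'M[F]_n) :
  in_Ms M <->
  [\/ M = [set 0],
      M = @scalar_set F n,
      M = @diagonalizable_set F n
    | M = @diagonalizable_set F n `&` @trace0_set F n].
Proof.
split=> [MM|[]->]; last first.
- exact: in_Ms_trace0.
- exact: in_Ms_diagonalizable.
- exact: in_Ms_scalar.
- exact: in_Ms_zero.
have [[v [i [j [Mv vij]]]]|noM] := pselect (exists v i j,
    M (diag_mx v) /\ v 0 i != v 0 j).
  by have [?|?] := Ms_nonconst MM Mv vij; [apply: Or43|apply: Or44].
have [|?|?] := Ms_const MM hn; [|by apply: Or41|by apply: Or42].
move=> d i j Md; have [//|dij] := eqVneq (d 0 i) (d 0 j).
by case: noM; exists d, i, j.
Qed.
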